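(* Let $m,n,r\ge 1$, $n_A\ge 1$, $\mu,\nu>0$, and let the data $M=[M_1\ \cdots\ M_{n_A}]\in\mathbb{R}^{m\times n}$, $\Omega_l$, $\mathcal{N}(l)$, $E_{lk}$, $f_l$ be as described in the context, with the area adjacency graph connected. Let $(\{\overline U_l\},\{\overline V_l\},\{\overline S_{lj}\},\{\overline q_{lj}\})$ be a stationary point of the decentralized problem $(\mathrm{P})$ defined in the context. Then $\overline U:=\overline U_1=\cdots=\overline U_{n_A}$, and with $\overline V:=[\overline V_1\ \cdots\ \overline V_{n_A}]\in\mathbb{R}^{r\times n}$ and $\overline X:=\overline U\,\overline V$, if $$\big\|\mu\,\mathcal{B}^*\big(\mathcal{B}(\overline X)-d\big)\big\|_2\le 1,$$ then $\overline X$ is a global minimizer of $$\min_{X\in\mathbb{R}^{m\times n}}\ \|X\|_*+\frac{\mu}{2}\|\mathcal{B}(X)-d\|_2^2 .$$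
   Context: Data: a matrix $M\in\mathbb{R}^{m\times n}$ whose column index set $\{1,\dots,n\}$ is partitioned into $n_A$ areas $A^1,\dots,A^{n_A}$ with $|A^l|=n_l$; write $M=[M_1\ \cdots\ M_{n_A}]$ with $M_l\in\mathbb{R}^{m\times n_l}$ the columns of area $l$, and similarly $X=[X_1\ \cdots\ X_{n_A}]$ for any $X\in\mathbb{R}^{m\times n}$. For each $l$, $\Omega_l$ is a set of observed entry positions of $M_l$, and $P_{\Omega_l}$ is the operator keeping entries in $\Omega_l$ and setting others to $0$; $\Omega=\bigcup_l\Omega_l$ (viewed as positions in $M$), with elements $(i_1,j_1),\dots,(i_{|\Omega|},j_{|\Omega|})$. $\mathcal{N}(l)\subseteq\{1,\dots,n_A\}\setminus\{l\}$ is the set of areas adjacent to area $l$ (symmetric relation); the graph on areas with these adjacencies is assumed connected. For each $l$ and each $k\in\{l\}\cup\mathcal{N}(l)$, $E_{lk}:\mathbb{R}^{m\times n_k}\to\mathbb{C}^{p_l}$ is a (real-)linear map acting on the columns of area $k$, and $f_l\in\mathbb{C}^{p_l}$. Decentralized problem $(\mathrm{P})$: minimize over $U_l\in\mathbb{R}^{m\times r}$, $V_l\in\mathbb{R}^{r\times n_l}$ ($l=1,\dots,n_A$), auxiliary $S_{lj}$ and $q_{lj}$ ($j\in\mathcal{N}(l)$) the function $$\sum_{l=1}^{n_A}\Big[\tfrac12\big(\tfrac1{n_A}\|U_l\|_F^2+\|V_l\|_F^2\big)+\tfrac{\mu}{2}\|P_{\Omega_l}(U_lV_l-M_l)\|_F^2+\tfrac{\nu}{2}\big\|E_{ll}(U_lV_l)+\textstyle\sum_{j\in\mathcal{N}(l)}q_{lj}-f_l\big\|_2^2\Big]$$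 subject to $U_l=S_{lj}=U_j$ and $E_{lj}(U_jV_j)=q_{lj}$ for all $l$ and all $j\in\mathcal{N}(l)$. A stationary point means a point satisfying the first-order (KKT) optimality conditions of this equality-constrained problem. The map $\mathcal{B}$ and vector $d$: $\mathcal{B}(X)=\big(X_{i_1j_1},\dots,X_{i_{|\Omega|}j_{|\Omega|}},\ \sqrt{\nu/\mu}\,(E_{11}(X_1)+\sum_{j\in\mathcal{N}(1)}E_{1j}(X_j)),\dots,\sqrt{\nu/\mu}\,(E_{n_An_A}(X_{n_A})+\sum_{j\in\mathcal{N}(n_A)}E_{n_Aj}(X_j))\big)$ and $d=\big(M_{i_1j_1},\dots,M_{i_{|\Omega|}j_{|\Omega|}},\sqrt{\nu/\mu}\,f_1,\dots,\sqrt{\nu/\mu}\,f_{n_A}\big)$. Complex coordinates are identified with pairs of real coordinates, so $\mathcal{B}$ is a real linear map into some $\mathbb{R}^L$; $\mathcal{B}^*$ is its adjoint with respect to the Frobenius inner product $\langle B,X\rangle_F=\mathrm{tr}(B^{\intercal}X)$ and the Euclidean inner product (i.e. if $[\mathcal{B}(X)]_i=\langle B_i,X\rangle_F$ then $\mathcal{B}^*(z)=\sum_i z_iB_i$). $\|\cdot\|_*$ is the nuclear norm and $\|\cdot\|_2$ applied to a matrix is the spectral norm. *)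

(* Defs.v *)
From HB Require Import structures.
From mathcomp Require Import all_boot all_order all_algebra.
From mathcomp Require Import all_classical all_reals all_analysis.
Set Implicit Arguments. Unset Strict Implicit. Unset Printing Implicit Defensive.
Import Order.TTheory GRing.Theory Num.Theory.
Local Open Scope ring_scope.

Section MatrixNorms.
Variable R : realType.

Definition fdot a b (A B : 'M[R]_(a, b)) : R := \sum_i \sum_j A i j * B i j.

Definition is_svd a b (X : 'M[R]_(a, b)) (U : 'M[R]_a) (S : 'M[R]_(a, b))
  (V : 'M[R]_b) : Prop :=
  [/\ U^T *m U = 1%:M, V^T *m V = 1%:M,
      (forall (i : 'I_a) (j : 'I_b), nat_of_ord i != nat_of_ord j -> S i j = 0),
      (forall i j, 0 <= S i j) & X = U *m S *m V^T].

(* a chosen SVD (one always exists) *)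
Definition svd a b (X : 'M[R]_(a, b)) : 'M[R]_a * 'M[R]_(a, b) * 'M[R]_b :=
  xget (1%:M, 0, 1%:M) [set t | is_svd X t.1.1 t.1.2 t.2].

Definition nucnorm a b (X : 'M[R]_(a, b)) : R :=
  \sum_i \sum_j (svd X).1.2 i j.

Definition specnorm a b (X : 'M[R]_(a, b)) : R :=
  \big[Num.max/0]_i \big[Num.max/0]_j (svd X).1.2 i j.

Definition Pmask a b (Om : {set 'I_a * 'I_b}) (X : 'M[R]_(a, b)) : 'M[R]_(a, b) :=
  \matrix_(i, j) (if (i, j) \in Om then X i j else 0).

End MatrixNorms.

Section Problem.
Local Unset Implicit Arguments.
Variable R : realType.
Variables (m r nA : nat) (nl : 'I_nA -> nat) (p : 'I_nA -> nat).
(* data: M_l, Omega_l, adjacency N(l), E_lk, f_l, mu, nu.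
   C^{p_l} is identified with R^{2 p_l}. *)
Variable M : forall l, 'M[R]_(m, nl l).
Variable Om : forall l, {set 'I_m * 'I_(nl l)}.
Variable adj : rel 'I_nA.
Variable E : forall l k, 'M[R]_(m, nl k) -> 'rV[R]_((p l).*2).
Variable f : forall l, 'rV[R]_((p l).*2).
Variables mu nu : R.

(* objective of (P); the auxiliary variables S l j, q l j are only used for
   j in N(l) (i.e. adj l j) *)
Definition objP (U : 'I_nA -> 'M[R]_(m, r)) (V : forall l, 'M[R]_(r, nl l))
  (S : 'I_nA -> 'I_nA -> 'M[R]_(m, r)) (q : forall l : 'I_nA, 'I_nA -> 'rV[R]_((p l).*2))
  : R :=
  \sum_(l < nA)
    ( 2^-1 * (fdot (U l) (U l) / nA%:R + fdot (V l) (V l))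
    + mu / 2 * fdot (Pmask (Om l) (U l *m V l - M l)) (Pmask (Om l) (U l *m V l - M l))
    + nu / 2 * fdot (E l l (U l *m V l) + \sum_(j | adj l j) q l j - f l)
                    (E l l (U l *m V l) + \sum_(j | adj l j) q l j - f l)).

Definition feasibleP U (V : forall l, 'M[R]_(r, nl l)) S
  (q : forall l : 'I_nA, 'I_nA -> 'rV[R]_((p l).*2)) : Prop :=
  forall l j, adj l j ->
    [/\ U l = S l j, S l j = U j & E l j (U j *m V j) = q l j].

Definition lagrP U (V : forall l, 'M[R]_(r, nl l)) S
  (q : forall l : 'I_nA, 'I_nA -> 'rV[R]_((p l).*2))
  (L1 L2 : 'I_nA -> 'I_nA -> 'M[R]_(m, r))
  (L3 : forall l : 'I_nA, 'I_nA -> 'rV[R]_((p l).*2)) : R :=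
  objP U V S q +
  \sum_(l < nA) \sum_(j | adj l j)
     ( fdot (L1 l j) (U l - S l j) + fdot (L2 l j) (S l j - U j)
     + fdot (L3 l j) (E l j (U j *m V j) - q l j)).

Definition stationaryP U (V : forall l, 'M[R]_(r, nl l)) S
  (q : forall l : 'I_nA, 'I_nA -> 'rV[R]_((p l).*2)) : Prop :=
  feasibleP U V S q /\
  exists L1 L2 L3, forall (dU : 'I_nA -> 'M[R]_(m, r))
      (dV : forall l, 'M[R]_(r, nl l)) (dS : 'I_nA -> 'I_nA -> 'M[R]_(m, r))
      (dq : forall l : 'I_nA, 'I_nA -> 'rV[R]_((p l).*2)),
    is_derive (0 : R) (1 : R)
      (fun t : R => lagrP (fun l => U l + t *: dU l) (fun l => V l + t *: dV l)
                         (fun l j => S l j + t *: dS l j)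
                         (fun l j => q l j + t *: dq l j) L1 L2 L3) 0.

Notation N := (\sum_(l < nA) nl l)%N.

(* codomain of B: the entries indexed by Omega (block l, positions Om l) and the
   vectors of R^{2 p_l}; inner product = Euclidean on exactly these coordinates *)
Definition Bspace := ((forall l, 'M[R]_(m, nl l)) * (forall l, 'rV[R]_((p l).*2)))%type.

Definition bdot (z w : Bspace) : R :=
  \sum_(l < nA) \sum_(ij in Om l) z.1 l ij.1 ij.2 * w.1 l ij.1 ij.2
  + \sum_(l < nA) fdot (z.2 l) (w.2 l).

Definition bsub (z w : Bspace) : Bspace :=
  (fun l => z.1 l - w.1 l, fun l => z.2 l - w.2 l).

Definition Bmap (X : 'M[R]_(m, N)) : Bspace :=
  (fun l => submxrow X l,
   fun l => Num.sqrt (nu / mu) *: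
              (E l l (submxrow X l) + \sum_(j | adj l j) E l j (submxrow X j))).

Definition dvec : Bspace := (M, fun l => Num.sqrt (nu / mu) *: f l).

(* adjoint: B^*(z) = sum_k z_k B_k with (B_k)_{ij} = [B(e_ij)]_k *)
Definition Bstar (z : Bspace) : 'M[R]_(m, N) :=
  \matrix_(i, j) bdot (Bmap (delta_mx i j)) z.

Definition objC (X : 'M[R]_(m, N)) : R :=
  nucnorm X + mu / 2 * bdot (bsub (Bmap X) dvec) (bsub (Bmap X) dvec).

End Problem.

Arguments objP {R m r nA nl p} M Om adj E f mu nu U V S q.
Arguments feasibleP {R m r nA nl p} adj E U V S q.
Arguments lagrP {R m r nA nl p} M Om adj E f mu nu U V S q L1 L2 L3.
Arguments stationaryP {R m r nA nl p} M Om adj E f mu nu U V S q.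
Arguments bdot {R m nA nl p} Om z w.
Arguments bsub {R m nA nl p} z w.
Arguments Bmap {R m nA nl p} adj E mu nu X.
Arguments dvec {R m nA nl p} M f mu nu.
Arguments Bstar {R m nA nl p} Om adj E mu nu z.
Arguments objC {R m nA nl p} M Om adj E f mu nu X.

(* Main.v *)
Require Import Defs.
From HB Require Import structures.
From mathcomp Require Import all_boot all_order all_algebra.
From mathcomp Require Import all_classical all_reals all_analysis.
From mathcomp Require Import complex spectral ring lra.
Import Order.TTheory GRing.Theory Num.Theory.
Local Open Scope ring_scope.
Set Implicit Arguments. Unset Strict Implicit. Unset Printing Implicit Defensive.

(* Put G := mu B^*(B(Xb) - d).  Testing the KKT system in the single direction
   that rescales all factors gives |U|^2 + |V|^2 + 2 <G, Xb> = 0.  Since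
   |U V|_* <= (|U|^2 + |V|^2) / 2, this yields |Xb|_* <= - <G, Xb>, while
   |G|_2 <= 1 gives |X|_* >= - <G, X> for every X.  So -G is a subgradient of
   the nuclear norm at Xb, and convexity of the quadratic term concludes.
   The norms of Defs are read off a chosen SVD, whose existence is proved by
   deflation: a singular pair comes from a nonzero eigenvalue of X^T X. *)

(** * Algebra of the Frobenius inner product *)

Section FrobeniusProduct.
Variable R : realType.

Lemma fdot_trace a b (A B : 'M[R]_(a, b)) : fdot A B = \tr (A^T *m B).
Proof.
rewrite /fdot exchange_big; apply: eq_bigr => j _; rewrite mxE.
by apply: eq_bigr => i _; rewrite mxE.
Qed.

Lemma fdotC a b (A B : 'M[R]_(a, b)) : fdot A B = fdot B A.
Proof. by apply: eq_bigr => i _; apply: eq_bigr => j _; rewrite mulrC. Qed.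

Lemma fdotDr a b (A B C : 'M[R]_(a, b)) : fdot A (B + C) = fdot A B + fdot A C.
Proof. by rewrite !fdot_trace mulmxDr mxtraceD. Qed.

Lemma fdotZr a b (A B : 'M[R]_(a, b)) k : fdot A (k *: B) = k * fdot A B.
Proof. by rewrite !fdot_trace -scalemxAr mxtraceZ. Qed.

Lemma fdotDl a b (A B C : 'M[R]_(a, b)) : fdot (A + B) C = fdot A C + fdot B C.
Proof. by rewrite fdotC fdotDr !(fdotC C). Qed.

Lemma fdotZl a b (A B : 'M[R]_(a, b)) k : fdot (k *: A) B = k * fdot A B.
Proof. by rewrite fdotC fdotZr fdotC. Qed.

Lemma fdotNr a b (A B : 'M[R]_(a, b)) : fdot A (- B) = - fdot A B.
Proof. by rewrite -scaleN1r fdotZr mulN1r. Qed.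

Lemma fdot0r a b (A : 'M[R]_(a, b)) : fdot A 0 = 0.
Proof. by rewrite fdot_trace mulmx0 mxtrace0. Qed.

Lemma fdot_ge0 a b (A : 'M[R]_(a, b)) : 0 <= fdot A A.
Proof. by do 2!apply: sumr_ge0 => ? _; rewrite -expr2 sqr_ge0. Qed.

Lemma fdot_eq0 a b (A : 'M[R]_(a, b)) : fdot A A = 0 -> A = 0.
Proof.
move=> /eqP; rewrite psumr_eq0 => [/allP h|i _]; last first.
  by apply: sumr_ge0 => ? _; rewrite -expr2 sqr_ge0.
apply/matrixP => i j; rewrite mxE; move: (h i); rewrite mem_index_enum => /(_ isT).
rewrite psumr_eq0 => [/allP /(_ j)|? _]; last by rewrite -expr2 sqr_ge0.
by rewrite mem_index_enum => /(_ isT); rewrite mulf_eq0 orbb => /eqP.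
Qed.

Lemma fdot_mull a b c (P : 'M[R]_(a, b)) (A : 'M[R]_(b, c)) B :
  fdot (P *m A) B = fdot A (P^T *m B).
Proof. by rewrite !fdot_trace trmx_mul mulmxA. Qed.

Lemma fdot_mulr a b c (Q : 'M[R]_(b, c)) (A : 'M[R]_(a, b)) B :
  fdot (A *m Q) B = fdot A (B *m Q^T).
Proof. by rewrite !fdot_trace trmx_mul -mulmxA mxtrace_mulC mulmxA. Qed.

Lemma fdot_orthol a b (P : 'M[R]_a) (A B : 'M[R]_(a, b)) :
  P^T *m P = 1%:M -> fdot (P *m A) (P *m B) = fdot A B.
Proof. by move=> h; rewrite fdot_mull mulmxA h mul1mx. Qed.

Lemma fdot_orthor a b (Q : 'M[R]_b) (A B : 'M[R]_(a, b)) :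
  Q *m Q^T = 1%:M -> fdot (A *m Q) (B *m Q) = fdot A B.
Proof. by move=> h; rewrite fdot_mulr -mulmxA h mulmx1. Qed.

Lemma fdot_delta a b (A : 'M[R]_(a, b)) i j : fdot A (delta_mx i j) = A i j.
Proof.
rewrite /fdot (bigD1 i) //= (bigD1 j) //= !big1 ?addr0.
- by rewrite mxE !eqxx mulr1.
- by move=> k ki; rewrite big1 // => l _; rewrite mxE (negbTE ki) mulr0.
- by move=> l lj; rewrite mxE (negbTE lj) andbF mulr0.
Qed.

End FrobeniusProduct.

(** * Existence of the SVD, and bounds on the nuclear and spectral norms *)

Section SingularValues.
Variable R : realType.

Lemma symmetric_neq0_eigenvalue n (A : 'M[R]_n) :
  A^T = A -> A != 0 -> exists2 x, x != 0 & eigenvalue A x.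
Proof.
(* Diagonalize [A] unitarily over [R[i]]: its eigenvalues there are real. *)
move=> symA A0; pose C := map_mx (real_complex R) A.
have hC : C \is hermsymmx.
  apply: realsym_hermsym.
    by rewrite qualifE /= expr0 scale1r map_mx_id // map_trmx symA.
  by apply/mxOverP => i j; rewrite mxE complex_real.
have /orthomx_spectralP := hermitian_normalmx hC.
move: (spectral_unit C) (hermitian_spectral_diag_real hC).
move: (spectralmx C) (spectral_diag C) => P d Pu /mxOverP dR CE.
(* An all-zero spectrum would make [C], hence [A], vanish. *)
have [i di0] : exists i, d 0 i != 0.
  apply/existsP; apply: contraNT A0 => /existsPn d0; apply/eqP.
  apply: (map_mx_inj (f := real_complex R)); rewrite map_mx0 -/C CE.
  suff -> : d = 0 by rewrite linear0 mulmx0 mul0mx.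
  by apply/rowP => i; have := d0 i; rewrite negbK mxE => /eqP.
have /complex_realP [x xE] := dR 0 i.
exists x; first by apply: contraNneq di0 => x0; rewrite xE x0.
have eC : eigenvalue C (d 0 i).
  apply/eigenvalueP; exists (row i P).
    rewrite CE -!row_mul !mulmxA mulmxV // mul1mx.
    by apply/rowP => j; rewrite mul_diag_mx !mxE.
  apply: contraTneq Pu => r0; rewrite unitmxE (expand_det_row _ i) big1 ?unitr0//.
  by move=> j _; move/rowP/(_ j): r0; rewrite !mxE => ->; rewrite mul0r.
(* The eigenvalue descends to [R] as a root of the characteristic polynomial, which commutes with
   the embedding of [R] into [R[i]]. *)
by move: eC; rewrite !eigenvalue_root_char xE -map_char_poly fmorph_root.
Qed.

Lemma orthogonal_first_col n (v : 'cV[R]_n.+1) : v^T *m v = 1%:M ->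
  exists2 P : 'M[R]_n.+1, P^T *m P = 1%:M & col 0 P = v.
Proof.
move=> v1; pose e : 'cV[R]_n.+1 := delta_mx 0 0.
have e1 : e^T *m e = 1%:M.
  by apply/matrixP => i j; rewrite !ord1 trmx_delta mul_delta_mx !mxE.
have [->|ve] := eqVneq v e.
  exists 1%:M; first by rewrite trmx1 mul1mx.
  by rewrite colE mul1mx.
(* [P] is the Householder reflection exchanging [e] and [v]. *)
pose w := v - e; pose s := (v^T *m e) 0 0.
have veE : v^T *m e = s%:M by rewrite [LHS]mx11_scalar.
have evE : e^T *m v = s%:M by apply: trmx_inj; rewrite trmx_mul trmxK tr_scalar_mx.
have wT : w^T = v^T - e^T by rewrite linearB.
have wwE : w^T *m w = (2 - 2 * s)%:M.
  rewrite wT mulmxBl !mulmxBr v1 e1 veE evE -!raddfB; congr (_%:M); ring.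
have weE : w^T *m e = (s - 1)%:M by rewrite wT mulmxBl e1 veE -raddfB.
(* This scalar is the squared length of [w], nonzero because [v] differs from [e]. *)
have c0 : 2 - 2 * s != 0.
  apply: contra_neq ve => c0; apply/eqP; rewrite -subr_eq0; apply/eqP.
  by apply: fdot_eq0; rewrite fdot_trace -/w wwE c0 raddf0 mxtrace0.
set c := 2 - 2 * s in wwE c0.
exists (1%:M - (2 / c) *: (w *m w^T)).
  have KT : (w *m w^T)^T = w *m w^T by rewrite trmx_mul trmxK.
  have KK : (w *m w^T) *m (w *m w^T) = c *: (w *m w^T).
    by rewrite mulmxA -(mulmxA w) wwE mul_mx_scalar -scalemxAl.
  move: (w *m w^T) KT KK => K KT KK.
  have -> : (1%:M - (2 / c) *: K)^T = 1%:M - (2 / c) *: K.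
    by rewrite [LHS]raddfB /= trmx1 -[in RHS]KT; congr (_ - _); rewrite linearZ.
  rewrite mulmxBl mul1mx mulmxBr mulmx1 -scalemxAl -scalemxAr scalerA KK.
  by apply/matrixP => i j; rewrite !mxE; field; exact: c0.
rewrite colE -/e mulmxBl mul1mx -scalemxAl -mulmxA weE mul_mx_scalar scalerA.
have -> : 2 / c * (s - 1) = -1 by rewrite /c; field.
by rewrite scaleN1r opprK addrC subrK.
Qed.

(** Take an eigenvector of [X^T *m X] with eigenvalue [x != 0]. The squared length of its image
    under [X] is [x] times its own, so [x > 0]. Then [s] is the square root of [x], [v] the
    normalized eigenvector and [u] the vector [X *m v] divided by [s]. Eigenvectors are rows here,
    whence the transposes. *)
Lemma singular_pair a b (X : 'M[R]_(a, b)) : X != 0 ->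
  exists s (u : 'cV[R]_a) (v : 'cV[R]_b),
    [/\ 0 < s, u^T *m u = 1%:M, v^T *m v = 1%:M,
        X *m v = s *: u & u^T *m X = s *: v^T].
Proof.
move=> X0; have [||x x0 /eigenvalueP [y yE y0]] := @symmetric_neq0_eigenvalue _ (X^T *m X).
- by rewrite trmx_mul trmxK.
- apply: contra_neq X0 => XX0; apply: fdot_eq0.
  by rewrite fdot_trace XX0 mxtrace0.
have yy_gt0 : 0 < fdot y y.
  rewrite lt_def fdot_ge0 andbT; apply: contra_neq y0; exact: fdot_eq0.
have XyE : fdot (y *m X^T) (y *m X^T) = x * fdot y y.
  by rewrite fdot_mulr trmxK -mulmxA yE fdotZr.
have x_gt0 : 0 < x.
  rewrite lt_def x0 /= -(pmulr_lge0 _ yy_gt0) -XyE; exact: fdot_ge0.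
have unit_col k (z : 'rV[R]_k) c : c * c * fdot z z = 1 -> (c *: z)^T^T *m (c *: z)^T = 1%:M.
  move=> h; rewrite trmxK [LHS]mx11_scalar; congr (_%:M); rewrite -h -mulrA -fdotZl -fdotZr.
  by rewrite /fdot big_ord1 mxE; apply: eq_bigr => j _; rewrite !mxE !mulrA.
pose s := Num.sqrt x; pose k := (Num.sqrt (fdot y y))^-1.
have s0 : s != 0 by rewrite gt_eqF // sqrtr_gt0.
have s2 : s * s = x by rewrite -expr2 sqr_sqrtr // ltW.
have k2 : k * k * fdot y y = 1.
  by rewrite -invfM -expr2 sqr_sqrtr ?fdot_ge0// mulVf // gt_eqF.
have trZ p q (A : 'M[R]_(p, q)) c : (c *: A)^T = c *: A^T by rewrite linearZ.
exists s, ((k / s) *: (y *m X^T))^T, (k *: y)^T; split.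
- by rewrite sqrtr_gt0.
- apply: unit_col; rewrite XyE -s2; rewrite -[RHS]k2; field; exact: s0.
- exact: unit_col.
- rewrite !trZ trmx_mul trmxK -scalemxAr scalerA; congr (_ *: _).
  by field; exact: s0.
- rewrite !trmxK -scalemxAl -mulmxA yE !scalerA -s2; congr (_ *: _).
  by field; exact: s0.
Qed.

(** Induction on the number of rows. In orthonormal bases starting with a singular pair, the first
    row and column of [X] vanish off the corner, and the remaining block is handled by induction. *)
Lemma svd_exists a b (X : 'M[R]_(a, b)) : exists t, is_svd X t.1.1 t.1.2 t.2.
Proof.
elim: a b X => [|a IH] b X; (have [->|X0] := eqVneq X 0; first
  by exists (1%:M, 0, 1%:M); split; rewrite ?trmx1 ?mulmx1 ?mulmx0 //=;
     move=> *; rewrite mxE).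
  by rewrite flatmx0 eqxx in X0.
case: b X X0 => [|b] X X0; first by rewrite thinmx0 eqxx in X0.
have [s [u [v [s0 u1 v1 Xv uX]]]] := singular_pair X0.
have [P PP Pu] := orthogonal_first_col u1.
have [Q QQ Qv] := orthogonal_first_col v1.
have PPt := mulmx1C PP; have QQt := mulmx1C QQ.
have rowY : row 0 (P^T *m X *m Q) = s *: row 0 1%:M.
  rewrite !row_mul -tr_col Pu uX -scalemxAl -Qv tr_col -row_mul.
  by rewrite QQ.
have colY : col 0 (P^T *m X *m Q) = s *: col 0 1%:M.
  by rewrite colE -2!mulmxA -[Q *m _]colE Qv Xv -scalemxAr -Pu colE mulmxA PP -colE.
(* Naming the product at sizes [1 + a] and [1 + b] makes it opaque and exposes its blocks. *)
have [Y YdE] : exists Y : 'M[R]_(1 + a, 1 + b), Y = P^T *m X *m Q by exists (P^T *m X *m Q).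
rewrite -YdE in rowY colY.
have [[[P' S'] Q'] /= [P'P' Q'Q' S'diag S'ge0 YE]] := IH _ (drsubmx Y).
have Y0j (j : 'I_(1 + b)) : Y 0 j = s * (0 == j)%:R.
  by move/rowP/(_ j): rowY; rewrite !mxE.
have Yi0 (i : 'I_(1 + a)) : Y i 0 = s * (i == 0)%:R.
  by move/colP/(_ i): colY; rewrite !mxE.
have l0 k : lshift k 0 = 0 :> 'I_(1 + k) by exact: val_inj.
have Yblock : Y = block_mx s%:M 0 0 (drsubmx Y).
  rewrite -[LHS]submxK; congr block_mx; apply/matrixP => i j; rewrite !mxE !ord1 ?l0.
  - by rewrite Y0j mulr1 mulr1n.
  - by rewrite Y0j mulr0.
  - by rewrite Yi0 mulr0.
pose up n (A : 'M[R]_n) : 'M[R]_(1 + n) := block_mx 1 0 0 A.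
pose T : 'M[R]_(1 + a, 1 + b) := block_mx s%:M 0 0 S'.
have orth n (A : 'M[R]_n) : A^T *m A = 1%:M -> (up n A)^T *m up n A = 1%:M.
  move=> AA; rewrite /up tr_block_mx mulmx_block !trmx0 trmx1.
  rewrite !mulmx0 !mul0mx mul1mx AA !addr0 !add0r.
  by rewrite -scalar_mx_block.
have YT : Y = up a P' *m T *m (up b Q')^T.
  rewrite Yblock YE /up /T tr_block_mx !trmx0 trmx1 !mulmx_block.
  by rewrite !mulmx0 !mul0mx mulmx1 !mul1mx !addr0 !add0r ?mul0mx.
have Tdiag (i : 'I_(1 + a)) (j : 'I_(1 + b)) : i != j :> nat -> T i j = 0.
  rewrite /T -(splitK i) -(splitK j).
  case: (fintype.split i) (fintype.split j) => i' [] j' /= ij.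
  + by rewrite !ord1 in ij.
  + by rewrite block_mxEur mxE.
  + by rewrite block_mxEdl mxE.
  + by rewrite block_mxEdr S'diag.
have T_ge0 (i : 'I_(1 + a)) (j : 'I_(1 + b)) : 0 <= T i j.
  rewrite /T -(splitK i) -(splitK j).
  case: (fintype.split i) (fintype.split j) => i' [] j' /=.
  + by rewrite block_mxEul mxE !ord1 ltW.
  + by rewrite block_mxEur mxE.
  + by rewrite block_mxEdl mxE.
  + by rewrite block_mxEdr.
exists (P *m up a P', T, Q *m up b Q'); split => //=.
- by rewrite trmx_mul mulmxA -(mulmxA _ P^T) PP mulmx1 orth.
- by rewrite trmx_mul mulmxA -(mulmxA _ Q^T) QQ mulmx1 orth.
- have XE : X = P *m Y *m Q^T.
    by rewrite YdE -!mulmxA QQt mulmx1 mulmxA PPt mul1mx.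
  by rewrite {1}XE YT trmx_mul !mulmxA.
Qed.

Lemma svdP a b (X : 'M[R]_(a, b)) : is_svd X (svd X).1.1 (svd X).1.2 (svd X).2.
Proof.
by apply: (@xgetPex _ (1%:M, 0, 1%:M) [set t | is_svd X t.1.1 t.1.2 t.2]); apply: svd_exists.
Qed.

(** Only diagonal entries of [F *m H] count, each the inner product of a row of [F] with a column of
    [H], bounded by half the sum of their squared lengths. It serves both norm bounds: [D] is the
    rectangular identity for the nuclear norm and the singular values of [G] for the spectral
    norm. *)
Lemma fdot_diag_mul_le a b k (D : 'M[R]_(a, b)) (F : 'M[R]_(a, k)) (H : 'M[R]_(k, b)) :
  (forall (i : 'I_a) (j : 'I_b), nat_of_ord i != nat_of_ord j -> D i j = 0) ->
  (forall i j, 0 <= D i j <= 1) ->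
  fdot D (F *m H) <= 2^-1 * (fdot F F + fdot H H).
Proof.
move=> Ddiag D01.
(* In a rectangular matrix a row or column meets the diagonal at most once, possibly never; hence an
   inequality. *)
have le1 (n i : nat) (x : R) : 0 <= x ->
    \sum_(j < n) (if i == j then x else 0) <= x.
  move=> x0; rewrite -big_mkcond /=; case: (ltnP i n) => [lt_in|le_ni].
    by rewrite (big_pred1 (Ordinal lt_in)).
  by rewrite big_pred0 // => j; apply/eqP => ij; move: (ltn_ord j); rewrite -ij ltnNge le_ni.
pose x i := \sum_l F i l ^+ 2; pose y j := \sum_l H l j ^+ 2.
have xE : fdot F F = \sum_i x i by do 2!apply: eq_bigr => ? _; rewrite expr2.
have yE : fdot H H = \sum_j y j.
  by rewrite /fdot exchange_big; do 2!apply: eq_bigr => ? _; rewrite expr2.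
have x0 i : 0 <= x i by apply: sumr_ge0 => *; exact: sqr_ge0.
have y0 i : 0 <= y i by apply: sumr_ge0 => *; exact: sqr_ge0.
have xy i j : (F *m H) i j <= 2^-1 * (x i + y j).
  rewrite mxE /x /y -big_split /= mulr_sumr; apply: ler_sum => l _.
  have := sqr_ge0 (F i l - H l j); nra.
have entry i j : D i j * (F *m H) i j <=
    2^-1 * (if (i : nat) == j then x i else 0) + 2^-1 * (if (i : nat) == j then y j else 0).
  case: eqP => [ij|/eqP ij]; last by rewrite Ddiag // mul0r !mulr0 addr0.
  have /andP[d0 d1] := D01 i j; rewrite -mulrDr.
  apply: le_trans (ler_wpM2l d0 (xy i j)) _.
  by rewrite ler_piMl // mulr_ge0 ?invr_ge0// addr_ge0.
apply: le_trans (ler_sum _ (fun i _ => ler_sum _ (fun j _ => entry i j))) _.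
under eq_bigr do rewrite big_split /= -!mulr_sumr.
rewrite big_split /= -!mulr_sumr -mulrDr ler_wpM2l ?invr_ge0// xE yE.
rewrite lerD //; first by apply: ler_sum => i _; apply: le1.
rewrite exchange_big; apply: ler_sum => j _ /=.
by under eq_bigr do rewrite eq_sym; apply: le1.
Qed.

(** The singular value matrix of the product is itself a product, of [P^T *m F] and [H *m Q], whose
    factors have the Frobenius norms of [F] and [H]. *)
Lemma nucnorm_mul_le a b k (F : 'M[R]_(a, k)) (H : 'M[R]_(k, b)) :
  nucnorm (F *m H) <= 2^-1 * (fdot F F + fdot H H).
Proof.
have := svdP (F *m H); rewrite /nucnorm; move: (svd _) => -[[P S] Q] /= [PP QQ Sdiag S0 FH].
pose D : 'M[R]_(a, b) := \matrix_(i, j) ((i : nat) == (j : nat))%:R.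
have -> : \sum_i \sum_j S i j = fdot D S.
  apply: eq_bigr => i _; apply: eq_bigr => j _; rewrite mxE.
  by case: eqP => [|/eqP/Sdiag ->]; rewrite ?mul1r ?mulr0.
have -> : S = (P^T *m F) *m (H *m Q).
  by rewrite mulmxA -(mulmxA P^T) FH !mulmxA PP mul1mx -mulmxA QQ mulmx1.
rewrite -[fdot F F](@fdot_orthol _ _ _ P^T) ?trmxK ?(mulmx1C PP)//.
rewrite -[fdot H H](@fdot_orthor _ _ _ Q) ?(mulmx1C QQ)//.
apply: fdot_diag_mul_le => i j; rewrite mxE; first by move=> /negbTE ->.
by rewrite ler0n lern1 leq_b1.
Qed.

(** One half of the duality between the two norms. In the singular bases of [Y], the inner product
    weights entries of [P^T *m G *m Q] by singular values of [Y], so it suffices that each entry is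
    at least [-1]. *)
Lemma fdot_ge_nucnorm a b (G Y : 'M[R]_(a, b)) : specnorm G <= 1 ->
  - nucnorm Y <= fdot G Y.
Proof.
have := svdP G; have := svdP Y; rewrite /nucnorm /specnorm; move: (svd G) (svd Y).
move=> [[P' S'] Q'] [[P S] Q] /= [PP QQ Sdiag S0 YE] [PP' QQ' Sdiag' S0' GE] hG.
have S1 i j : S' i j <= 1.
  by apply: le_trans hG; apply: le_trans (le_bigmax _ _ i); apply: le_bigmax.
have -> : fdot G Y = fdot (P^T *m G *m Q) S.
  by rewrite fdot_mulr fdot_mull trmxK mulmxA -YE.
rewrite /fdot -sumrN; apply: ler_sum => i _; rewrite -sumrN; apply: ler_sum => j _.
suff : -1 <= (P^T *m G *m Q) i j by move=> h; rewrite -mulN1r ler_wpM2r.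
pose K := P'^T *m P; pose L := Q'^T *m Q.
have KK : K^T *m K = 1%:M.
  by rewrite trmx_mul trmxK mulmxA -(mulmxA P^T) (mulmx1C PP') mulmx1.
have LL : L^T *m L = 1%:M.
  by rewrite trmx_mul trmxK mulmxA -(mulmxA Q^T) (mulmx1C QQ') mulmx1.
(* In the singular bases of [G] the entry pairs [S'] with a rank-one product of unit vectors. Moving
   the sign into one factor turns the upper bound of [fdot_diag_mul_le] into the lower bound
   wanted. *)
have -> : (P^T *m G *m Q) i j = - fdot S' (- col i K *m (col j L)^T).
  have -> : - col i K *m (col j L)^T = - (K *m (delta_mx i j *m L^T)).
    rewrite mulNmx !colE trmx_mul trmx_delta -!mulmxA (mulmxA (delta_mx i 0)).
    by rewrite mul_delta_mx.
  rewrite fdotNr opprK fdotC fdot_mull fdot_mulr trmxK fdotC fdot_delta.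
  by rewrite GE trmx_mul trmxK !mulmxA.
have S01 k l : 0 <= S' k l <= 1 by rewrite S0' S1.
rewrite lerN2; apply: le_trans (fdot_diag_mul_le _ _ Sdiag' S01) _.
have col1 c (A : 'M[R]_c) k : A^T *m A = 1%:M -> fdot (col k A) (col k A) = 1.
  by move=> AA; rewrite colE fdot_orthol // fdot_delta mxE !eqxx.
have fdotT c (x : 'cV[R]_c) : fdot x^T x^T = fdot x x.
  by rewrite !fdot_trace trmxK mxtrace_mulC.
rewrite -(scaleN1r (col i K)) fdotZl fdotZr fdotT !col1 //; lra.
Qed.
End SingularValues.

(** * Derivatives at 0 along polynomial curves *)

Section Curves.
Variable R : realType.

(** Degree four suffices: the test curve moves the products [U l *m V l] quadratically, and the
    objective squares them. *)
Lemma is_derive_quartic (c0 c1 c2 c3 c4 : R) :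
  is_derive (0 : R) (1 : R)
    (fun t => c0 + c1 * t + c2 * t ^+ 2 + c3 * t ^+ 3 + c4 * t ^+ 4) c1.
Proof.
pose P : {poly R} := c0%:P + c1 *: 'X + c2 *: 'X^2 + c3 *: 'X^3 + c4 *: 'X^4.
have -> : (fun t => c0 + c1 * t + c2 * t ^+ 2 + c3 * t ^+ 3 + c4 * t ^+ 4) = horner P.
  by apply/funext => t; rewrite /P !hornerE.
apply: is_derive_eq (is_derive_poly P 0) _.
by rewrite /P !poly.derivE !(hornerE, hornerMn) /=; ring.
Qed.

Lemma is_derive_fdot a b (F : R -> 'M[R]_(a, b)) A B C :
  (forall t, F t = A + t *: B + t ^+ 2 *: C) ->
  is_derive (0 : R) (1 : R) (fun t => fdot (F t) (F t)) (2 * fdot A B).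
Proof.
move=> FE; have -> : (fun t => fdot (F t) (F t)) = (fun t => fdot A A + 2 * fdot A B * t
  + (fdot B B + 2 * fdot A C) * t ^+ 2 + 2 * fdot B C * t ^+ 3 + fdot C C * t ^+ 4).
  apply/funext => t; rewrite FE !(fdotDl, fdotDr, fdotZl, fdotZr).
  by rewrite (fdotC B A) (fdotC C A) (fdotC C B); ring.
exact: is_derive_quartic.
Qed.

Lemma is_derive_lincomb (f g : R -> R) k h x df dg :
  is_derive x (1 : R) f df -> is_derive x (1 : R) g dg ->
  is_derive x (1 : R) (fun t => k * f t + h * g t) (k * df + h * dg).
Proof. by move=> df' dg'; exact: (is_deriveD (is_deriveZ k df') (is_deriveZ h dg')). Qed.

Lemma is_derive_sum_pointwise n (h : 'I_n -> R -> R) x (dh : 'I_n -> R) :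
  (forall i, is_derive x (1 : R) (h i) (dh i)) ->
  is_derive x (1 : R) (fun t => \sum_(i < n) h i t) (\sum_(i < n) dh i).
Proof. by move=> hd; rewrite -(fct_sumE _ _ h); apply: is_derive_sum. Qed.

End Curves.

(** * Linearity of the measurement map, its adjoint, and convexity of the data fit *)

Section Measurements.
Variables (R : realType) (m nA : nat) (nl p : 'I_nA -> nat).
Variables (Om : forall l, {set 'I_m * 'I_(nl l)}) (adj : rel 'I_nA).
Variable E : forall l k, 'M[R]_(m, nl k) -> 'rV[R]_((p l).*2).
Arguments E : clear implicits.
Variables mu nu : R.
Hypothesis E_linear : forall l k, linear (E l k).

Lemma PmaskP a b (O : {set 'I_a * 'I_b}) k (A B : 'M[R]_(a, b)) :
  Pmask O (k *: A + B) = k *: Pmask O A + Pmask O B.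
Proof. by apply/matrixP => i j; rewrite !mxE; case: ifP; rewrite ?mulr0 ?addr0. Qed.

Lemma bdotE (z w : Bspace R m nA nl p) : bdot Om z w =
  \sum_l (fdot (Pmask (Om l) (z.1 l)) (Pmask (Om l) (w.1 l)) + fdot (z.2 l) (w.2 l)).
Proof.
rewrite big_split /=; congr (_ + _); apply: eq_bigr => l _.
rewrite /fdot pair_big /= [LHS]big_mkcond; apply: eq_bigr => -[i j] _ /=.
by rewrite !mxE; case: ifP; rewrite ?mulr0.
Qed.

Lemma bdotC (z w : Bspace R m nA nl p) : bdot Om z w = bdot Om w z.
Proof. by rewrite !bdotE; apply: eq_bigr => l _; congr (_ + _); apply: fdotC. Qed.

Lemma bdot_ge0 (z : Bspace R m nA nl p) : 0 <= bdot Om z z.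
Proof. by rewrite bdotE sumr_ge0 // => l _; rewrite addr_ge0 ?fdot_ge0. Qed.

(** The hypotheses are blockwise because points of [Bspace] are pairs of functions; no equality
    between functions has to be proved. *)
Lemma bdot_linearl k (u z w v : Bspace R m nA nl p) :
  (forall l, u.1 l = k *: z.1 l + w.1 l) -> (forall l, u.2 l = k *: z.2 l + w.2 l) ->
  bdot Om u v = k * bdot Om z v + bdot Om w v.
Proof.
move=> u1 u2; rewrite !bdotE mulr_sumr -big_split; apply: eq_bigr => l _ /=.
by rewrite u1 u2 PmaskP !fdotDl !fdotZl; ring.
Qed.

Lemma Bmap_linear1 k X Y l : (Bmap adj E mu nu (k *: X + Y)).1 l =
  k *: (Bmap adj E mu nu X).1 l + (Bmap adj E mu nu Y).1 l.
Proof. by apply/matrixP => i j; rewrite !mxE. Qed.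

Lemma Bmap_linear2 k X Y l : (Bmap adj E mu nu (k *: X + Y)).2 l =
  k *: (Bmap adj E mu nu X).2 l + (Bmap adj E mu nu Y).2 l.
Proof.
rewrite /Bmap /=.
have sE j : submxrow (k *: X + Y) j = k *: submxrow X j + submxrow Y j.
  by apply/matrixP => i i'; rewrite !mxE.
rewrite sE E_linear; under eq_bigr do rewrite sE E_linear.
rewrite big_split -scaler_sumr /=.
rewrite addrACA -scalerDr [LHS]scalerDr; congr (_ + _).
by rewrite !scalerA mulrC.
Qed.

(** Both sides are linear in [Y] and agree on the matrices [delta_mx i j], by definition of
    [Bstar]. *)
Lemma fdot_Bstar z Y : fdot (Bstar Om adj E mu nu z) Y = bdot Om (Bmap adj E mu nu Y) z.
Proof.
pose phi Y := bdot Om (Bmap adj E mu nu Y) z.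
have phiP k A B : phi (k *: A + B) = k * phi A + phi B.
  by apply: bdot_linearl => l; [exact: Bmap_linear1 | exact: Bmap_linear2].
have phiD A B : phi (A + B) = phi A + phi B.
  by rewrite -[A in LHS]scale1r phiP mul1r.
have phi0 : phi 0 = 0 by apply: (addrI (phi 0)); rewrite -phiD !addr0.
have phiZ k A : phi (k *: A) = k * phi A.
  by rewrite -[k *: A]addr0 phiP phi0 addr0.
rewrite -[RHS]/(phi Y) [in RHS](matrix_sum_delta Y) (big_morph phi phiD phi0).
apply: eq_bigr => i _; rewrite (big_morph phi phiD phi0); apply: eq_bigr => j _.
by rewrite phiZ mxE mulrC.
Qed.

(** The gradient inequality for a convex quadratic: the term dropped is the squared norm of the
    image of [Y - X]. *)
Lemma bdot_residual_ge (d : Bspace R m nA nl p) X Y :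
  bdot Om (bsub (Bmap adj E mu nu X) d) (bsub (Bmap adj E mu nu X) d)
  + 2 * bdot Om (Bmap adj E mu nu (Y - X)) (bsub (Bmap adj E mu nu X) d)
    <= bdot Om (bsub (Bmap adj E mu nu Y) d) (bsub (Bmap adj E mu nu Y) d).
Proof.
pose res X := bsub (Bmap adj E mu nu X) d; rewrite -/(res X) -/(res Y).
set D := Bmap adj E mu nu (Y - X).
have YE : Y = 1 *: (Y - X) + X by rewrite scale1r subrK.
have resE v : bdot Om (res Y) v = bdot Om D v + bdot Om (res X) v.
  rewrite -[bdot Om D v]mul1r; apply: bdot_linearl => l.
    have e := Bmap_linear1 1 (Y - X) X l; rewrite -YE in e.
    by rewrite [LHS](congr1 (fun x => x - d.1 l) e) addrA.
  have e := Bmap_linear2 1 (Y - X) X l; rewrite -YE in e.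
  by rewrite [LHS](congr1 (fun x => x - d.2 l) e) addrA.
rewrite resE !(bdotC _ (res Y)) !resE (bdotC (res X) D).
have := bdot_ge0 D; lra.
Qed.

End Measurements.

(** * Consequences of the KKT conditions *)

Section KKT.
Variables (R : realType) (m r nA : nat) (nl p : 'I_nA -> nat).
Variable M : forall l, 'M[R]_(m, nl l).
Variables (Om : forall l, {set 'I_m * 'I_(nl l)}) (adj : rel 'I_nA).
Variable E : forall l k, 'M[R]_(m, nl k) -> 'rV[R]_((p l).*2).
Arguments E : clear implicits.
Variable f : forall l, 'rV[R]_((p l).*2).
Variables mu nu : R.
Hypotheses (E_linear : forall l k, linear (E l k)) (mu_gt0 : 0 < mu) (nu_gt0 : 0 < nu).
Variables (U : 'I_nA -> 'M[R]_(m, r)) (V : forall l, 'M[R]_(r, nl l)).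
Variables (S : 'I_nA -> 'I_nA -> 'M[R]_(m, r)).
Variable q : forall l : 'I_nA, 'I_nA -> 'rV[R]_((p l).*2).

Lemma feasible_consensus : (forall l k, connect adj l k) ->
  feasibleP adj E U V S q -> forall l k, U l = U k.
Proof.
move=> conn feas l k; have /connectP [s + ->] := conn l k.
elim: s l => [//|j s IH] l /= /andP[lj /IH <-].
by have [-> -> _] := feas _ _ lj.
Qed.

Lemma E_linear0 l k : E l k 0 = 0.
Proof.
have := @E_linear l k 1 0 0; rewrite !scale1r addr0 => h.
by apply: (addrI (E l k 0)); rewrite -h addr0.
Qed.

Lemma E_linearZ l k c X : E l k (c *: X) = c *: E l k X.
Proof. by rewrite -[c *: X]addr0 E_linear E_linear0 addr0. Qed.

(* The KKT system is tested against the direction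
   [(dU, dV, dS, dq) = (U, V, S, 2 q)]: it scales the products [U_l V_l] by
   [(1 + t)^2], so the constraints hold along it up to [O(t^2)] and the
   multipliers drop out. *)
Lemma stationary_balance : stationaryP M Om adj E f mu nu U V S q ->
  \sum_(l < nA) (fdot (U l) (U l) / nA%:R + fdot (V l) (V l)
    + 2 * mu * fdot (Pmask (Om l) (U l *m V l)) (Pmask (Om l) (U l *m V l - M l))
    + 2 * nu * fdot (E l l (U l *m V l) + \sum_(j | adj l j) E l j (U j *m V j))
        (E l l (U l *m V l) + \sum_(j | adj l j) E l j (U j *m V j) - f l)) = 0.
Proof.
move=> [feas [L1 [L2 [L3 /(_ U V S (fun l j => 2 *: q l j)) stat]]]].
have qE l : \sum_(j | adj l j) E l j (U j *m V j) = \sum_(j | adj l j) q l j.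
  by apply: eq_bigr => j lj; have [] := feas l j lj.
under eq_bigr do rewrite qE.
have UVE l (t : R) : (U l + t *: U l) *m (V l + t *: V l) = (1 + 2 * t + t ^+ 2) *: (U l *m V l).
  rewrite -[U l in LHS]scale1r -[V l in LHS]scale1r !scalerA -!scalerDl -scalemxAl -scalemxAr scalerA.
  by congr (_ *: _); ring.
set g := (fun t : R => _) in stat.
(* All that survives of the multiplier terms is [c * t ^+ 2], which has zero derivative at 0. *)
pose c := \sum_(l < nA) \sum_(j | adj l j) fdot (L3 l j) (q l j).
pose a1 l (t : R) := fdot (U l + t *: U l) (U l + t *: U l).
pose a2 l (t : R) := fdot (V l + t *: V l) (V l + t *: V l).
pose W l (t : R) := Pmask (Om l) ((1 + 2 * t + t ^+ 2) *: (U l *m V l) - M l).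
pose Z l (t : R) := (1 + 2 * t + t ^+ 2) *: E l l (U l *m V l)
   + \sum_(j | adj l j) (q l j + t *: (2 *: q l j)) - f l.
have gE : g = (fun t => \sum_(l < nA) ((2^-1 * (nA%:R^-1 * a1 l t + 1 * a2 l t)
    + mu / 2 * fdot (W l t) (W l t)) + nu / 2 * fdot (Z l t) (Z l t))
    + (0 + 0 * t + c * t ^+ 2 + 0 * t ^+ 3 + 0 * t ^+ 4)).
  apply/funext => t; rewrite /g /lagrP /objP; congr (_ + _).
    apply: eq_bigr => l _; rewrite /a1 /a2 /W /Z -E_linearZ !UVE.
    by rewrite mul1r [_ / nA%:R]mulrC.
  rewrite !mul0r !addr0 !add0r /c mulr_suml; apply: eq_bigr => l _.
  rewrite mulr_suml; apply: eq_bigr => j lj.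
  have [US SU Eq] := feas l j lj.
  (* The consensus residuals vanish for every [t], since [U] and [S] are scaled alike. *)
  rewrite UVE E_linearZ Eq US SU !subrr !fdot0r !add0r.
  have -> : (1 + 2 * t + t ^+ 2) *: q l j - (q l j + t *: (2 *: q l j)) = t ^+ 2 *: q l j.
    by apply/matrixP => i k; rewrite !mxE; ring.
  by rewrite fdotZr mulrC.
have da1 l : is_derive (0 : R) (1 : R) (a1 l) (2 * fdot (U l) (U l)).
  by apply: (is_derive_fdot (C := 0)) => t; rewrite scaler0 addr0.
have da2 l : is_derive (0 : R) (1 : R) (a2 l) (2 * fdot (V l) (V l)).
  by apply: (is_derive_fdot (C := 0)) => t; rewrite scaler0 addr0.
have dW l : is_derive (0 : R) (1 : R) (fun t => fdot (W l t) (W l t))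
    (2 * fdot (Pmask (Om l) (U l *m V l - M l)) (2 *: Pmask (Om l) (U l *m V l))).
  apply: (is_derive_fdot (C := Pmask (Om l) (U l *m V l))) => t.
  by apply/matrixP => i j; rewrite !mxE; case: ifP => _; ring.
have dZ l : is_derive (0 : R) (1 : R) (fun t => fdot (Z l t) (Z l t))
    (2 * fdot (E l l (U l *m V l) + \sum_(j | adj l j) q l j - f l)
     (2 *: (E l l (U l *m V l) + \sum_(j | adj l j) q l j))).
  apply: (is_derive_fdot (C := E l l (U l *m V l))) => t.
  rewrite /Z big_split /= -!scaler_sumr.
  by apply/matrixP => i j; rewrite !mxE; ring.
have dg : is_derive (0 : R) (1 : R) g (\sum_(l < nA)
    (2^-1 * (nA%:R^-1 * (2 * fdot (U l) (U l)) + 1 * (2 * fdot (V l) (V l)))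
    + mu / 2 * (2 * fdot (Pmask (Om l) (U l *m V l - M l)) (2 *: Pmask (Om l) (U l *m V l)))
    + nu / 2 * (2 * fdot (E l l (U l *m V l) + \sum_(j | adj l j) q l j - f l)
     (2 *: (E l l (U l *m V l) + \sum_(j | adj l j) q l j)))) + 0).
  have dsum l := is_deriveD (is_derive_lincomb 2^-1 (mu / 2)
    (is_derive_lincomb nA%:R^-1 1 (da1 l) (da2 l)) (dW l)) (is_deriveZ (nu / 2) (dZ l)).
  rewrite gE.
  exact: (is_deriveD (is_derive_sum_pointwise dsum) (is_derive_quartic 0 0 c 0 0)).
(* The computed derivative of [g] must equal the value 0 given by stationarity. *)
have := @derive_val _ _ _ _ _ _ _ dg; rewrite (@derive_val _ _ _ _ _ _ _ stat) addr0 => h; rewrite [RHS]h.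
apply: eq_bigr => l _.
rewrite !fdotZr (fdotC (Pmask _ (_ - _))) [fdot (_ - _) _]fdotC; field.
by rewrite pnatr_eq0 lt0n_neq0 // (leq_ltn_trans _ (ltn_ord l)).
Qed.

(** Reassembles the balance over areas: by consensus the [nA] shares of [U] add up to one squared
    norm, and the squared weight in [Bmap] times [mu] restores [nu]. *)
Lemma stationary_subgradient l0 : (forall l k, U l = U k) ->
  stationaryP M Om adj E f mu nu U V S q ->
  let Xb := U l0 *m \mxrow_(k < nA) V k in
  2^-1 * (fdot (U l0) (U l0) + fdot (\mxrow_(k < nA) V k) (\mxrow_(k < nA) V k)) =
  - (mu * bdot Om (Bmap adj E mu nu Xb) (bsub (Bmap adj E mu nu Xb) (dvec M f mu nu))).
Proof.
move=> Ueq /stationary_balance bal Xb.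
have Xbl l : submxrow Xb l = U l *m V l by rewrite /Xb mul_mxrow mxrowK (Ueq l l0).
have VV : fdot (\mxrow_(k < nA) V k) (\mxrow_(k < nA) V k) = \sum_l fdot (V l) (V l).
  rewrite fdot_trace mxtrace_mulC tr_mxrow mul_mxrow_mxcol raddf_sum.
  by apply: eq_bigr => l _; rewrite fdot_trace mxtrace_mulC.
have UU : fdot (U l0) (U l0) = \sum_(l < nA) fdot (U l) (U l) / nA%:R.
  rewrite (eq_bigr (fun=> fdot (U l0) (U l0) / nA%:R)) => [|l _]; last by rewrite (Ueq l l0).
  rewrite sumr_const card_ord -[RHS]mulr_natr divfK //.
  by rewrite pnatr_eq0 lt0n_neq0 // (leq_ltn_trans _ (ltn_ord l0)).
have s2 : mu * (Num.sqrt (nu / mu) * Num.sqrt (nu / mu)) = nu.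
  rewrite -expr2 sqr_sqrtr ?divr_ge0 ?ltW//; field; exact: lt0r_neq0.
have BB : mu * bdot Om (Bmap adj E mu nu Xb) (bsub (Bmap adj E mu nu Xb) (dvec M f mu nu)) =
    \sum_(l < nA) (mu * fdot (Pmask (Om l) (U l *m V l)) (Pmask (Om l) (U l *m V l - M l))
    + nu * fdot (E l l (U l *m V l) + \sum_(j | adj l j) E l j (U j *m V j))
        (E l l (U l *m V l) + \sum_(j | adj l j) E l j (U j *m V j) - f l)).
  rewrite bdotE mulr_sumr; apply: eq_bigr => l _; rewrite /= Xbl.
  under eq_bigr do rewrite Xbl.
  by rewrite -scalerBr fdotZl fdotZr -[in RHS]s2; ring.
rewrite BB UU VV.
have: \sum_(l < nA) fdot (U l) (U l) / nA%:R + \sum_l fdot (V l) (V l) +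
   2 * \sum_(l < nA) (mu * fdot (Pmask (Om l) (U l *m V l)) (Pmask (Om l) (U l *m V l - M l))
    + nu * fdot (E l l (U l *m V l) + \sum_(j | adj l j) E l j (U j *m V j))
        (E l l (U l *m V l) + \sum_(j | adj l j) E l j (U j *m V j) - f l)) = 0.
  by rewrite mulr_sumr -!big_split -[RHS]bal; apply: eq_bigr => l _ /=; ring.
lra.
Qed.

End KKT.

Theorem theorem1 (R : realType) (m r nA : nat) (nl p : 'I_nA -> nat)
  (M : forall l, 'M[R]_(m, nl l)) (Om : forall l, {set 'I_m * 'I_(nl l)})
  (adj : rel 'I_nA) (E : forall l k, 'M[R]_(m, nl k) -> 'rV[R]_((p l).*2))
  (f : forall l, 'rV[R]_((p l).*2)) (mu nu : R)
  (U : 'I_nA -> 'M[R]_(m, r)) (V : forall l, 'M[R]_(r, nl l))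
  (S : 'I_nA -> 'I_nA -> 'M[R]_(m, r))
  (q : forall l : 'I_nA, 'I_nA -> 'rV[R]_((p l).*2)) :
  (0 < m)%N -> (0 < r)%N -> (0 < nA)%N -> (forall l, 0 < nl l)%N ->
  0 < mu -> 0 < nu ->
  (forall l, ~~ adj l l) -> (forall l k, adj l k = adj k l) ->
  (forall l k, connect adj l k) ->
  (forall l k, linear (E l k)) ->
  stationaryP M Om adj E f mu nu U V S q ->
  (forall l k, U l = U k) /\
  (forall l, let Xb := U l *m \mxrow_(k < nA) V k in
     specnorm (mu *: Bstar Om adj E mu nu (bsub (Bmap adj E mu nu Xb) (dvec M f mu nu))) <= 1 ->
     forall X, objC M Om adj E f mu nu Xb <= objC M Om adj E f mu nu X).
Proof.
move=> _ _ _ _ mu_gt0 nu_gt0 _ _ conn E_linear stat.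
have Ueq := feasible_consensus conn stat.1.
split=> // l0 Xb G1 X.
have key := stationary_subgradient E_linear mu_gt0 nu_gt0 l0 Ueq stat.
rewrite -/Xb in key.
(* The nuclear norm of [Xb] is at most minus its inner product with the gradient [mu *: Bstar] of
   the data fit. *)
have nucXb := nucnorm_mul_le (U l0) (\mxrow_(k < nA) V k); rewrite -/Xb key in nucXb.
have nucX := fdot_ge_nucnorm X G1.
have fit := bdot_residual_ge Om adj mu nu E_linear (dvec M f mu nu) Xb X.
have BXXb : fdot (Bstar Om adj E mu nu (bsub (Bmap adj E mu nu Xb) (dvec M f mu nu))) (X - Xb)
  = bdot Om (Bmap adj E mu nu (X - Xb)) (bsub (Bmap adj E mu nu Xb) (dvec M f mu nu)).
  exact: fdot_Bstar.
move: nucX nucXb fit; rewrite -BXXb -fdot_Bstar // fdotZl fdotDr fdotNr /objC.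
set B := fdot _ X; set B' := fdot _ Xb; set r1 := bdot _ _ _; set r2 := bdot _ _ _.
move=> nucX nucXb fit.
(* The linear terms of the two nuclear norm bounds cancel against that of the data fit, scaled by
   [mu / 2]. *)
have := ler_wpM2l (ltW mu_gt0) fit; lra.
Qed.
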